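(* For every sufficiently large positive integer $k$ and every $c\ge 0.7\cdot 2^k$, there is a constant $\varepsilon>0$ such that the following holds. Let $\{F_n\}_{n\in\mathbb{N}}$ be a sequence of random $k$-CNFs, each $F_n$ drawn independently from $\mathcal{F}(k,n,cn)$. With probability $1$, there is a non-uniform decision tree reduction of block-depth $2$ from $\textsc{Refuter}(s(F_n\vdash_{\mathsf{Res}}\bot)<(1+\varepsilon)^n)$ to $\mathrm{rwPHP}(\mathsf{PLS})$ that is correct for all sufficiently large $n$.
   Context: $\mathcal{F}(k,n,m)$ is the distribution on $k$-CNFs over $n$ variables with $m$ clauses, each clause chosen independently and uniformly among all $\binom{n}{k}2^k$ ordinary width-$k$ clauses (no variable appears both positively and negatively). $\textsc{Refuter}(s(F\vdash_{\mathsf{Res}}\bot)<s)$: input is a purported resolution refutation of $F$ with fewer than $s$ nodes (each node: clause, tag resolution/weakening, earlier predecessor indices and resolved variable; valid iff the resolution rule $C\vee x,D\vee\overline x\vdash C\vee D$ or weakening $C\vdash C\vee D$ is correctly applied; last clause empty); a solution is an index of an invalid node; each node is a block. $\textsc{Iter}$: input $S:[L]\to[L]$; solutions $x$ with $x=0\wedge S(0)=0$, or $S(x)<x$, or $S(x)>x\wedge S(S(x))=S(x)$. $\mathrm{rwPHP}(\mathsf{PLS})$: input $f:[M]\to[N]$ with $M\le N/2$, for each $y\in[N]$ an $\textsc{Iter}$ instance $S_y:[L]\to[L]$ and $g_y:[L]\to[M]$; a solution is $(y,a)$ with $a$ a solution of $S_y$ and $f(g_y(a))\ne y$. *)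

(* Defs.v *)
From HB Require Import structures.
From mathcomp Require Import all_boot all_order all_algebra.
From mathcomp Require Import all_classical all_reals all_analysis.
Set Implicit Arguments. Unset Strict Implicit. Unset Printing Implicit Defensive.
Import Order.TTheory GRing.Theory Num.Theory.
Local Open Scope ring_scope.
Local Open Scope classical_set_scope.

(* CNFs.  A literal over n variables is a pair (v, b) : 'I_n * bool,    *)
(* b = true meaning the positive literal v, b = false the negation.     *)
Definition clause (n : nat) := {set ('I_n * bool)%type}.
Definition cnf (n m : nat) := {ffun 'I_m -> clause n}.

Definition ordinary_kclause (k n : nat) (C : clause n) : bool :=
  (#|C| == k) && [forall v : 'I_n, ~~ (((v, true) \in C) && ((v, false) \in C))].

Definition is_kcnf (k n m : nat) (F : cnf n m) : bool :=
  [forall j : 'I_m, ordinary_kclause k (F j)].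

Definition num_clauses {R : realType} (c : R) (n : nat) : nat := Num.truncn (c * n%:R).

Definition mutually_independent {d} {Omega : measurableType d} {R : realType}
  (P : probability Omega R) (T : nat -> Type) (X : forall n, Omega -> T n) : Prop :=
  forall (I : seq nat) (A : forall n, set (T n)), uniq I ->
    P (\bigcap_(i in [set` I]) (X i @^-1` A i)) =
    \big[*%E/1%E]_(i <- I) P (X i @^-1` A i).

(* Decision trees whose queries return whole blocks: index type I,      *)
(* block alphabet A, output type O.                                     *)
Inductive dtree (I A O : Type) : Type :=
  | DLeaf : O -> dtree I A O
  | DQuery : I -> (A -> dtree I A O) -> dtree I A O.
Arguments DLeaf {I A O}.
Arguments DQuery {I A O}.

Fixpoint dt_eval {I A O : Type} (t : dtree I A O) (x : I -> A) : O :=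
  match t with
  | DLeaf o => o
  | DQuery i k => dt_eval (k (x i)) x
  end.

Fixpoint dt_depth_le {I A O : Type} (t : dtree I A O) (d : nat) : Prop :=
  match t with
  | DLeaf _ => True
  | DQuery _ k => match d with
                  | 0 => False
                  | d'.+1 => forall a, dt_depth_le (k a) d'
                  end
  end.

(* A node (block) is (clause, tag, pred1, pred2, resolved variable);    *)
(* tag = true : resolution, tag = false : weakening (uses pred1 only).  *)
(* A predecessor is either an axiom (inl j : clause j of F) or an       *)
(* earlier node (inr j, required j < i).                                *)
Definition rnode (n m l : nat) :=
  (clause n * bool * ('I_m + 'I_l) * ('I_m + 'I_l) * 'I_n)%type.

Definition refutation (n m l : nat) := 'I_l -> rnode n m l.

Section Refuter.
Variables (n m l : nat) (F : cnf n m) (x : refutation n m l).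

Definition node_clause (v : rnode n m l) : clause n := v.1.1.1.1.
Definition node_tag (v : rnode n m l) : bool := v.1.1.1.2.
Definition node_p1 (v : rnode n m l) : 'I_m + 'I_l := v.1.1.2.
Definition node_p2 (v : rnode n m l) : 'I_m + 'I_l := v.1.2.
Definition node_var (v : rnode n m l) : 'I_n := v.2.

Definition ptr_clause (p : 'I_m + 'I_l) : clause n :=
  match p with inl j => F j | inr j => node_clause (x j) end.

Definition ptr_earlier (i : 'I_l) (p : 'I_m + 'I_l) : bool :=
  match p with inl _ => true | inr j => (j < i)%N end.

Definition node_valid (i : 'I_l) : bool :=
  let v := x i in
  let C := node_clause v in
  let C1 := ptr_clause (node_p1 v) in
  let C2 := ptr_clause (node_p2 v) in
  let z := node_var v in
  (if node_tag v then
     [&& ptr_earlier i (node_p1 v), ptr_earlier i (node_p2 v),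
         (z, true) \in C1, (z, false) \in C2 &
         C == (C1 :\ (z, true)) :|: (C2 :\ (z, false))]
   else ptr_earlier i (node_p1 v) && (C1 \subset C))
  && ((i.+1 == l)%N ==> (C == finset.set0)).

Definition refuter_sol (i : 'I_l) : bool := ~~ node_valid i.
End Refuter.

Definition iter_sol (L : nat) (S : 'I_L -> 'I_L) (a : 'I_L) : bool :=
  [|| ((a == 0 :> nat) && (S a == 0 :> nat)),
      (S a < a)%N |
      ((a < S a)%N && (S (S a) == S a))].

Definition rwphp_sol (M N L : nat) (f : 'I_M -> 'I_N)
  (S : 'I_N -> 'I_L -> 'I_L) (g : 'I_N -> 'I_L -> 'I_M) (y : 'I_N) (a : 'I_L) : bool :=
  iter_sol (S y) a && (f (g y a) != y).

(* Parameters: 0 < M, 0 < L, M <= N/2 (these make rwPHP(PLS) total).    *)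
Definition refuter_dt_reduces_to_rwphp (n m l : nat) (F : cnf n m) (d : nat) : Prop :=
  exists (M N L : nat),
  [/\ (0 < M)%N, (0 < L)%N & (2 * M <= N)%N] /\
  exists (tf : 'I_M -> dtree 'I_l (rnode n m l) 'I_N)
         (tS : 'I_N -> 'I_L -> dtree 'I_l (rnode n m l) 'I_L)
         (tg : 'I_N -> 'I_L -> dtree 'I_l (rnode n m l) 'I_M)
         (tsol : 'I_N -> 'I_L -> dtree 'I_l (rnode n m l) 'I_l),
  [/\ (forall i, dt_depth_le (tf i) d),
      (forall y a, dt_depth_le (tS y a) d),
      (forall y a, dt_depth_le (tg y a) d),
      (forall y a, dt_depth_le (tsol y a) d) &
      forall (x : refutation n m l) (y : 'I_N) (a : 'I_L),
        rwphp_sol (fun i => dt_eval (tf i) x) (fun y a => dt_eval (tS y a) x)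
                  (fun y a => dt_eval (tg y a) x) y a ->
        refuter_sol F x (dt_eval (tsol y a) x)].

Definition refuter_reduces_bd {R : realType} (s : R) (n m : nat) (F : cnf n m) (d : nat) : Prop :=
  forall l : nat, (0 < l)%N -> l%:R < s -> refuter_dt_reduces_to_rwphp l F d.

(* Main.v *)
(* The reduction encodes a size lower bound by random restrictions.  A word [y]
   picks a small random set of variables together with values for them; after
   releasing the variables of the few clauses of [F] that meet this set too often,
   the restricted formula still expands, so every small set of its clauses is
   satisfiable.  Calling a clause alive when it can be falsified together with any
   [s] clauses of [F], expansion makes aliveness pass from a conclusion with at most
   [s] variables to one of the premises, and never to a clause of [F].  Hence for each
   [y] the walk from the last node through alive clauses is an Iter instance that
   ends at an invalid node or at an alive clause with more than [s] variables.  A clause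
   that wide is satisfied under all but an exponentially small fraction of the words,
   so [y] can be decoded from the node of a wide alive clause and an index that is
   much shorter than [y]: this is the map [f] of rwPHP(PLS).  The expansion of random
   formulas fails with probability O(1/n^2), and Borel-Cantelli applies. *)
Require Import Defs.
From HB Require Import structures.
From mathcomp Require Import all_boot zify.
Set Implicit Arguments. Unset Strict Implicit. Unset Printing Implicit Defensive.

(** * Boundary expansion *)

Section Hypergraph.
Variables (I T : finType) (V : I -> {set T}).
Implicit Types (A : {set I}) (U : {set T}).

Definition span A : {set T} := \bigcup_(j in A) V j.
Definition degree A v := #|[set j in A | v \in V j]|.
Definition boundary A : {set T} := [set v | degree A v == 1].

Lemma sum_degree A U : \sum_(v in U) degree A v = \sum_(j in A) #|V j :&: U|.
Proof.
under eq_bigr => v _ do rewrite /degree -sum1_card big_mkcond /=.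
rewrite exchange_big [RHS]big_mkcond /=; apply: eq_bigr => j _.
case: ifP => jA; last first.
  by rewrite big1 // => v _; rewrite inE jA.
rewrite -sum1_card big_mkcond [RHS]big_mkcond /=; apply: eq_bigr => v _.
by rewrite !inE jA /=; case: (v \in U); case: (v \in V j).
Qed.

Lemma degree_gt0 A v : (0 < degree A v) = (v \in span A).
Proof.
apply/card_gt0P/bigcupP => [[j]|[j jA vj]]; first by rewrite inE => /andP[]; exists j.
by exists j; rewrite inE jA.
Qed.

Lemma sum_degree_span A U :
  \sum_(v in span A :&: U) degree A v = \sum_(j in A) #|V j :&: U|.
Proof.
rewrite sum_degree; apply: eq_bigr => j jA; apply: eq_card => v.
rewrite !inE; case: (boolP (v \in V j)) => //= vj.
by have /bigcupP -> : exists2 i, i \in A & v \in V i by exists j.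
Qed.

Lemma boundary_span A : boundary A \subset span A.
Proof. by apply/subsetP => v; rewrite inE -degree_gt0 => /eqP->. Qed.

(** When degrees are summed over the span, a vertex outside the boundary counts at least twice. *)
Lemma leq_span_boundary A : 2 * #|span A| <= #|boundary A| + \sum_(j in A) #|V j|.
Proof.
have -> : \sum_(j in A) #|V j| = \sum_(v in span A) degree A v.
  rewrite -(setIT (span A)) sum_degree_span.
  by apply: eq_bigr => j _; rewrite setIT.
rewrite -[in X in _ <= X + _](setIidPr (boundary_span A)) -sum1_card.
rewrite -[#|_ :&: _|]sum1_card big_distrr /=.
rewrite [X in _ <= X + _](eq_bigl (fun v => (v \in span A) && (v \in boundary A))); last first.
  by move=> v; rewrite inE.
rewrite big_mkcondr -big_split /=; apply: leq_sum => v.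
by rewrite -degree_gt0 inE; case: (degree A v) => [|[|d]].
Qed.

Lemma span_cap_le A U : #|span A :&: U| <= \sum_(j in A) #|V j :&: U|.
Proof.
rewrite -sum_degree_span -sum1_card; apply: leq_sum => v.
by rewrite inE -degree_gt0 => /andP[].
Qed.

Lemma boundary_expansion k A U :
    (forall j, #|V j| <= k) -> (forall j, 4 * #|V j :&: U| <= k) ->
    3 * k * #|A| <= 4 * #|span A| ->
  k * #|A| <= 4 * #|boundary A :\: U|.
Proof.
move=> Vk VU expA.
have h1 := leq_span_boundary A.
have h2 : \sum_(j in A) #|V j| <= k * #|A|.
  by rewrite mulnC -sum_nat_const; apply: leq_sum.
have h3 : 4 * #|boundary A :&: U| <= k * #|A|.
  have h : #|boundary A :&: U| <= \sum_(j in A) #|V j :&: U|.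
    by apply: leq_trans (span_cap_le A U); rewrite subset_leq_card ?setSI ?boundary_span.
  apply: leq_trans (_ : 4 * \sum_(j in A) #|V j :&: U| <= _); first by rewrite leq_mul2l h orbT.
  by rewrite big_distrr mulnC -sum_nat_const; apply: leq_sum.
have h4 := cardsID U (boundary A).
nia.
Qed.

End Hypergraph.

(** * Clauses, assignments and aliveness under a restriction *)

Section Clauses.
Variable n : nat.
Implicit Types (C D : clause n) (sigma : {ffun 'I_n -> bool}).

Definition vars C : {set 'I_n} := [set L.1 | L in C].

Definition satisfies sigma C := [exists v, (v, sigma v) \in C].

Lemma mem_vars C v b : (v, b) \in C -> v \in vars C.
Proof. by move=> vC; apply/imsetP; exists (v, b). Qed.

Lemma satisfiesS sigma C D : C \subset D -> satisfies sigma C -> satisfies sigma D.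
Proof. by move=> /subsetP CD /existsP[v vC]; apply/existsP; exists v; exact: CD. Qed.

Lemma satisfiesU1 sigma z b C :
  satisfies sigma ((z, b) |: C) = (sigma z == b) || satisfies sigma C.
Proof.
apply/existsP/orP => [[v]|[/eqP <-|/existsP[v vC]]].
- rewrite !inE => /orP[/eqP[-> ->]|vC]; [by left|right].
  by apply/existsP; exists v.
- by exists z; rewrite !inE eqxx.
- by exists v; rewrite !inE vC orbT.
Qed.

Definition flip sigma v : {ffun 'I_n -> bool} :=
  [ffun u => if u == v then ~~ sigma u else sigma u].

Lemma satisfies_flip sigma v C : v \notin vars C ->
  satisfies (flip sigma v) C = satisfies sigma C.
Proof.
move=> vC; apply/eq_existsb => u; rewrite ffunE.
case: eqP => // ->; apply/idP/idP => /mem_vars h; by rewrite h in vC.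
Qed.

Lemma satisfied_flip sigma v C : v \in vars C ->
  satisfies sigma C || satisfies (flip sigma v) C.
Proof.
case/imsetP => -[u b] /= uC ->; case: (eqVneq (sigma u) b) => [e|].
  by apply/orP; left; apply/existsP; exists u; rewrite e.
move=> /negPf e; apply/orP; right; apply/existsP; exists u; rewrite ffunE eqxx.
by move: e uC; case: (sigma u); case: b.
Qed.

End Clauses.

(* The restriction is given by the set [U] of restricted variables and the
   values of [beta] on it. *)
Section Alive.
Variables (n m k s : nat) (F : cnf n m) (U : {set 'I_n}) (beta : 'I_n -> bool).
Implicit Types (C D : clause n) (A B : {set 'I_m}) (sigma : {ffun 'I_n -> bool}).

Hypothesis k_gt3 : 3 < k.
Hypothesis s_gt0 : 0 < s.
Hypothesis F_width : forall j, #|vars (F j)| <= k.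
Hypothesis F_restr : forall j, 4 * #|vars (F j) :&: U| <= k.
Hypothesis F_expand : forall A, 0 < #|A| <= 2 * s ->
  3 * k * #|A| <= 4 * #|span (fun j => vars (F j)) A|.

Definition refutes_with sigma A C :=
  [&& [forall v in U, sigma v == beta v], [forall j in A, satisfies sigma (F j)]
    & ~~ satisfies sigma C].

Definition falsifiable A C := [exists sigma, refutes_with sigma A C].

Definition alive C := [forall A : {set 'I_m}, (#|A| <= s) ==> falsifiable A C].

Lemma falsifiableS A B C D :
  A \subset B -> C \subset D -> falsifiable B D -> falsifiable A C.
Proof.
move=> /subsetP AB CD /existsP[sigma /and3P[sU /forall_inP sB sD]].
apply/existsP; exists sigma; apply/and3P; split=> //.
- by apply/forall_inP => j /AB; exact: sB.
- by apply: contra sD; exact: satisfiesS.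
Qed.

Lemma aliveS C D : C \subset D -> alive D -> alive C.
Proof.
move=> CD /forallP aD; apply/forallP => A; apply/implyP => sA.
by move/implyP: (aD A) => /(_ sA); exact: falsifiableS.
Qed.

Lemma alive_falsifiable C A : alive C -> #|A| <= s -> falsifiable A C.
Proof. by move=> /forallP/(_ A)/implyP. Qed.

(* A minimal set of clauses implying [C] under the restriction has all its
   unrestricted boundary variables in [C]: flipping any other one would
   satisfy the only clause of the set that it occurs in. *)
Lemma unfalsifiable_core A C :
    #|A| <= 2 * s -> falsifiable finset.set0 C -> ~~ falsifiable A C ->
  exists B, [/\ 0 < #|B|, B \subset A, ~~ falsifiable B C
                & k * #|B| <= 4 * #|vars C|].
Proof.
move=> sA f0 nfA.
have [B /minsetP[nfB minB] BA] := @minset_exists _ (fun B => ~~ falsifiable B C) A nfA.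
have B_gt0 : 0 < #|B|.
  by rewrite card_gt0; apply: contraNneq nfB => ->.
exists B; split=> //.
apply: leq_trans (boundary_expansion (U := U) F_width F_restr _) _.
  by apply: F_expand; rewrite B_gt0 (leq_trans _ sA) // subset_leq_card.
rewrite leq_mul2l /= subset_leq_card //; apply/subsetP => v.
rewrite !inE => /andP[vU /cards1P[j def_j]].
have: j \in [set j] by rewrite inE.
rewrite -def_j inE => /andP[jB vj].
apply: contraR nfB => vC.
have: falsifiable (B :\ j) C.
  apply: contraT => nfBj; have := minB _ nfBj (subsetDl _ _).
  by move=> e; move: jB; rewrite -e !inE eqxx.
case/existsP => sigma /and3P[/forall_inP sU /forall_inP sB sC].
have [sj|nsj] := boolP (satisfies sigma (F j)).
  apply/existsP; exists sigma; apply/and3P; split=> //; first exact/forall_inP.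
  apply/forall_inP => i iB; case: (eqVneq i j) => [-> //|ij].
  by apply: sB; rewrite !inE ij.
apply/existsP; exists (flip sigma v); apply/and3P; split.
- apply/forall_inP => u uU; rewrite ffunE; case: (eqVneq u v) => [uv|_]; last exact: sU.
  by rewrite -uv uU in vU.
- apply/forall_inP => i iB; case: (eqVneq i j) => [->|ij].
    by have := satisfied_flip sigma vj; rewrite (negPf nsj).
  rewrite satisfies_flip; first by apply: sB; rewrite !inE ij.
  apply/negP => vi; have: i \in [set j] by rewrite -def_j inE iB.
  by rewrite inE (negPf ij).
- by rewrite satisfies_flip.
Qed.

(** A core would be nonempty, yet its size is bounded by the number of variables of the empty
    clause. *)
Lemma alive_nil : alive finset.set0.
Proof.
apply/forallP => A; apply/implyP => sA; apply: contraT => nf.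
have f0 : falsifiable finset.set0 finset.set0.
  apply/existsP; exists [ffun v => beta v]; apply/and3P; split.
  - by apply/forall_inP => v _; rewrite ffunE.
  - by apply/forall_inP => j; rewrite inE.
  - by apply/existsP => -[v]; rewrite inE.
have [|B [B_gt0 _ _]] := unfalsifiable_core _ f0 nf; first by lia.
rewrite /vars imset0 cards0 muln0; nia.
Qed.

Lemma alive_axiom C j : F j \subset C -> ~~ alive C.
Proof.
move=> FC; apply/negP => aC; have := alive_falsifiable (A := [set j]) aC; rewrite cards1 => /(_ s_gt0).
case/existsP => sigma /and3P[_ /forall_inP sj]; apply/negP; rewrite negbK.
by apply: satisfiesS FC _; apply: sj; rewrite inE.
Qed.

(** If both extensions fail, at [A1] and [A0], then [A1 :|: A0] excludes falsifying [C], whatever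
    the value of [z]. It has up to [2 * s] clauses, the range of [F_expand]. Its core has more than
    [s] clauses because [C] is alive, but at most [4 * s / k] because [C] is narrow. *)
Lemma alive_extend C z : alive C -> #|vars C| <= s ->
  alive ((z, true) |: C) || alive ((z, false) |: C).
Proof.
move=> aC sC; apply: contraT; rewrite negb_or => /andP[].
case/forallPn => A1; rewrite negb_imply => /andP[sA1 nf1].
case/forallPn => A0; rewrite negb_imply => /andP[sA0 nf0].
have nf : ~~ falsifiable (A1 :|: A0) C.
  apply/existsP => -[sigma /and3P[sU /forall_inP sA nC]].
  case: (boolP (sigma z)) => sz; [move: nf0|move: nf1].
  - apply/negP; rewrite negbK; apply/existsP; exists sigma; apply/and3P; split=> //.
      by apply/forall_inP => j jA; apply: sA; rewrite inE jA orbT.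
    by rewrite satisfiesU1 sz.
  - apply/negP; rewrite negbK; apply/existsP; exists sigma; apply/and3P; split=> //.
      by apply/forall_inP => j jA; apply: sA; rewrite inE jA.
    by rewrite satisfiesU1 (negPf sz).
have f0 : falsifiable finset.set0 C by apply: alive_falsifiable; rewrite ?cards0.
have sA : #|A1 :|: A0| <= 2 * s.
  by have [h _] := leq_card_setU A1 A0; lia.
have [B [B_gt0 _ nfB]] := unfalsifiable_core sA f0 nf.
have: s < #|B|.
  by rewrite ltnNge; apply: contra nfB; exact: alive_falsifiable.
nia.
Qed.

Lemma alive_not_sat C v : alive C -> v \in U -> (v, beta v) \notin C.
Proof.
move=> aC vU; have : falsifiable finset.set0 C.
  by apply: alive_falsifiable; rewrite ?cards0.
case/existsP => sigma /and3P[/forall_inP/(_ v vU)/eqP <- _].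
by apply: contra => vC; apply/existsP; exists v.
Qed.

End Alive.

(** * From Delayer strategies to rwPHP(PLS) *)

Section DtMap.
Variables (I A O O' : Type) (h : O -> O').

(** Relabelling leaves costs no query, so the trees for [S], [g] and the solution can all be read
    off one walk. *)
Fixpoint dt_map (t : dtree I A O) : dtree I A O' :=
  match t with
  | DLeaf o => DLeaf (h o)
  | DQuery i k => DQuery i (fun a => dt_map (k a))
  end.

Lemma dt_eval_map t x : dt_eval (dt_map t) x = h (dt_eval t x).
Proof. by elim: t => //= i k IH; exact: IH. Qed.

Lemma dt_depth_map t d : dt_depth_le t d -> dt_depth_le (dt_map t) d.
Proof. by elim: t d => //= i k IH [|d] //= H a; apply: IH; exact: H. Qed.

End DtMap.

Section Walk.
Variables (n m l s : nat) (F : cnf n m) (alive : pred (clause n)).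
Implicit Types (C D : clause n) (i j : 'I_l) (v : rnode n m l) (x : refutation n m l).

Hypothesis alive0 : alive finset.set0.
Hypothesis aliveW : forall C D, C \subset D -> alive D -> alive C.
Hypothesis axiom_not_alive : forall C (j : 'I_m), F j \subset C -> ~~ alive C.
Hypothesis alive_ext : forall C z, alive C -> #|vars C| <= s ->
  alive ((z, true) |: C) || alive ((z, false) |: C).

Definition narrow C := #|vars C| <= s.

(* The premise to move to, and the clause that contains it if the node is valid. *)
Definition target v : ('I_m + 'I_l) * clause n :=
  if node_tag v then
    if alive ((node_var v, true) |: node_clause v)
    then (node_p1 v, (node_var v, true) |: node_clause v)
    else (node_p2 v, (node_var v, false) |: node_clause v)
  else (node_p1 v, node_clause v).

(** Validity of a resolution node can involve three nodes, but only two may be read. Testing that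
    the chosen premise lies inside [(target v).2] suffices: success passes aliveness on, and failure
    at a narrow alive node exposes an error. *)
Definition walk i : dtree 'I_l (rnode n m l) (option ('I_l * clause n)) :=
  DQuery i (fun v =>
    if alive (node_clause v) && narrow (node_clause v) then
      if (target v).1 is inr j then
        if j < i then
          DQuery j (fun v' => DLeaf (if node_clause v' \subset (target v).2
                                     then Some (j, node_clause v') else None))
        else DLeaf None
      else DLeaf None
    else DLeaf None).

Lemma walk_depth i : dt_depth_le (walk i) 2.
Proof.
move=> v /=; case: ifP => // _; case: (target v).1 => // j.
by case: ifP.
Qed.

Lemma target_alive v :
  alive (node_clause v) -> narrow (node_clause v) -> alive (target v).2.
Proof.
move=> aC nC; rewrite /target; case: ifP => // _; case: ifP => // h.
by have := alive_ext (node_var v) aC nC; rewrite h.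
Qed.

Lemma walk_some x i j C : dt_eval (walk i) x = Some (j, C) ->
  [/\ j < i, C = node_clause (x j) & alive C].
Proof.
rewrite /=; case: ifP => // /andP[aC nC].
case E: (target (x i)).1 => [//|j'].
case: ifP => // ji /=; case: ifP => // sub [<- <-]; split=> //.
by apply: aliveW sub _; exact: target_alive.
Qed.

(** At a valid node the chosen premise is earlier and contained in the alive target clause. So it is
    no axiom, and the walk would have moved. *)
Lemma walk_none x i : alive (node_clause (x i)) -> narrow (node_clause (x i)) ->
  dt_eval (walk i) x = None -> refuter_sol F x i.
Proof.
move=> aC nC; rewrite /= aC nC /= => stuck; apply/negP => valid.
have at2 := target_alive aC nC.
suff [early sub] : ptr_earlier i (target (x i)).1 /\
    ptr_clause F x (target (x i)).1 \subset (target (x i)).2.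
  case E: (target (x i)).1 early sub stuck => [j|j] /=.
    by move=> _ /axiom_not_alive; rewrite at2.
  by move=> -> /= ->.
move: valid; rewrite /node_valid /target => /andP[+ _].
case: (node_tag (x i)); last by move=> /andP[].
case/and5P => e1 e2 _ _ /eqP def_C.
case: ifP => _ /=; split=> //; rewrite def_C.
(* The only literal of the premise that the resolvent may lack is the resolved one, which the target
   clause adds back. *)
- apply/subsetP => L L1; rewrite !inE L1 andbT.
  by case: (eqVneq L (node_var (x i), true)).
- apply/subsetP => L L2; rewrite !inE L2 andbT.
  by case: (eqVneq L (node_var (x i), false)) => //=; rewrite orbT.
Qed.

End Walk.

(* For each [y : Y], the clauses satisfying [alive y] are those that a Delayer
   following strategy [y] may admit to be false; every wide clause is admitted
   by few strategies only. *)
Theorem strategies_reduction (n m l s K : nat) (F : cnf n m) (Y : finType)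
    (alive : Y -> pred (clause n)) :
    0 < l -> 0 < K -> 2 * (l * K) <= #|Y| ->
    (forall y, alive y finset.set0) ->
    (forall y (C D : clause n), C \subset D -> alive y D -> alive y C) ->
    (forall y (C : clause n) (j : 'I_m), F j \subset C -> ~~ alive y C) ->
    (forall y (C : clause n) z, alive y C -> #|vars C| <= s ->
      alive y ((z, true) |: C) || alive y ((z, false) |: C)) ->
    (forall C : clause n, s < #|vars C| -> #|[set y | alive y C]| <= K) ->
  refuter_dt_reduces_to_rwphp l F 2.
Proof.
case: l => // l _; case: K => // K _ leYK alive0 aliveW axiom_na alive_ext wideK.
pose code := ('I_l.+1 * 'I_K.+1)%type.
have M_gt0 : 0 < #|{: code}| by rewrite card_prod !card_ord.
have N_gt0 : 0 < #|Y| by apply: leq_trans leYK; rewrite !muln_gt0.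
pose y0 : Y := enum_val (Ordinal N_gt0).
exists #|{: code}|, #|Y|, l.+1; split.
  by split=> //; rewrite card_prod !card_ord.
pose cand (C : clause n) := enum [set y | alive y C].
pose dec (y : 'I_#|Y|) : Y := enum_val y.
(* Iter moves upwards while premises precede conclusions, so position [a] stands for node
   [rev_ord a], and 0 for the last node. *)
pose W (y : 'I_#|Y|) a : dtree 'I_l.+1 (rnode n m l.+1) _ := walk m s (alive (dec y)) (rev_ord a).
pose node (a : 'I_l.+1) (o : option ('I_l.+1 * clause n)) :=
  if o is Some (j, _) then j else rev_ord a.
pose dec_code (e : 'I_#|{: code}|) : code := enum_val e.
(* A node [j] with clause [C] determines [y] up to its rank in the short list [cand C]. Where the
   walk stops, the code is an arbitrary default. *)
pose guess (y : Y) (o : option ('I_l.+1 * clause n)) : code :=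
  if o is Some (j, C) then (j, inord (index y (cand C))) else (ord0, ord0).
exists (fun e => DQuery (dec_code e).1 (fun v =>
          DLeaf (enum_rank (nth y0 (cand (node_clause v)) (dec_code e).2)))),
  (fun y a => dt_map (fun o => rev_ord (node a o)) (W y a)),
  (fun y a => dt_map (fun o => enum_rank (guess (dec y) o)) (W y a)),
  (fun y a => dt_map (node a) (W y a)).
split=> //; try by move=> y a; apply: dt_depth_map; exact: walk_depth.
move=> x y a; rewrite /rwphp_sol /iter_sol !dt_eval_map.
set ali := alive (dec y).
have Wnone b : dt_eval (W y b) x = None -> ali (node_clause (x (rev_ord b))) ->
    narrow s (node_clause (x (rev_ord b))) -> refuter_sol F x (rev_ord b).
  move=> Wb aC nC; apply: walk_none Wb => //; [exact: (axiom_na (dec y))|exact: (alive_ext (dec y))].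
case Wa: (dt_eval (W y a) x) => [[j C]|]; rewrite /node; last first.
  (* A stopped walk is a fixed point, hence a solution only at 0. If the last node were valid, its
     clause would be empty, so alive and narrow, and the stop would prove the node invalid. *)
  rewrite rev_ordK ltnn /= orbF => /andP[/andP[/eqP a0 _] _].
  apply/negP => valid.
  suff e0 : node_clause (x (rev_ord a)) = finset.set0.
    have := Wnone a Wa; rewrite e0 /narrow /vars imset0 cards0 => /(_ (alive0 _) isT).
    by rewrite /refuter_sol valid.
  by case/andP: valid => _ /implyP h; apply/eqP/h; rewrite /= a0 subn1.
have [ji defC aC] := walk_some (aliveW _) (alive_ext _) Wa.
have ltaj : a < rev_ord j.
  by rewrite /=; have := ltn_ord a; have := ltn_ord j; move: ji => /=; lia.
rewrite [(rev_ord j < a)%N]ltnNge (ltnW ltaj) ltaj orFb andTb.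
case/andP => h fg.
(* Since [a] moves up, it is a solution only if its successor is a fixed point, that is, if the walk
   stops at node [j]. *)
have Sj : dt_eval (W y (rev_ord j)) x = None.
  case Wj: (dt_eval (W y (rev_ord j)) x) h => [[j' C']|] //.
  have [jj' _ _] := walk_some (aliveW _) (alive_ext _) Wj.
  case/orP => [/andP[_ /eqP e]|/eqP/rev_ord_inj e]; first by move: ltaj; rewrite e.
  by move: jj'; rewrite e rev_ordK ltnn.
have := Wnone _ Sj; rewrite rev_ordK -defC => /(_ aC); apply.
(* If [C] were wide, [f] would decode the guess back to [y]. *)
rewrite /narrow leqNgt; apply/negP => wC.
move/negP: fg; apply; apply/eqP.
rewrite /= /dec_code enum_rankK /= -defC inordK; last first.
  have : index (dec y) (cand C) < size (cand C) by rewrite index_mem mem_enum inE.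
  rewrite -cardE => h'; exact: leq_trans h' (wideK _ wC).
by rewrite nth_index ?enum_valK // mem_enum inE.
Qed.

(** * Random restrictions *)

(** Bernoulli's inequality [(1 + 1/z)^x >= 1 + x/z], cleared of denominators. *)
Lemma double_expn_pred z x : 0 < z -> z < x -> 2 * z ^ x <= z.+1 ^ x.
Proof.
move=> z_gt0 zx.
have h : (z + x) * z ^ x <= z * z.+1 ^ x.
  elim: x {zx} => [|x IH]; first by rewrite addn0 !expn0.
  rewrite !expnS; nia.
rewrite -(leq_pmul2l z_gt0); apply: leq_trans h.
rewrite mulnA leq_mul2r; apply/orP; right; lia.
Qed.

Lemma leq_exp2r_le a b e : a <= b -> a ^ e <= b ^ e.
Proof. by move=> ab; case: e => // e; rewrite leq_exp2r. Qed.

Lemma markov_card (T : finType) (P : pred T) (w : T -> nat) (a : nat) :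
  (forall x, P x -> a <= w x) -> #|[set x | P x]| * a <= \sum_x w x.
Proof.
move=> h; rewrite -sum1_card big_distrl /=.
rewrite big_mkcond /=; apply: leq_sum => x _; rewrite inE mul1n.
by case: ifP => // /h.
Qed.

Section Words.
Variables (n q : nat).
Notation Q := q.+1.
Notation letter := (bool * 'I_Q)%type.
Implicit Types (y : {ffun 'I_n -> letter}) (W : {set 'I_n}) (C : clause n).

(* A restricted variable [v] takes the value [(y v).1]; the density of
   [restricted y] is [1 / Q]. *)
Definition restricted y : {set 'I_n} := [set v | (y v).2 == ord0].

Definition hits y C : {set 'I_n} := [set v in restricted y | (v, (y v).1) \in C].

Lemma sum_words (w : 'I_n -> letter -> nat) :
  \sum_(y : {ffun 'I_n -> letter}) \prod_v w v (y v) = \prod_v \sum_b \sum_(i < Q) w v (b, i).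
Proof.
rewrite -bigA_distr_bigA; apply: eq_bigr => v _.
by rewrite pair_bigA /=; apply: eq_bigr => -[].
Qed.

Lemma prodn_mem W (a b : nat) :
  \prod_v (if v \in W then a else b) = a ^ #|W| * b ^ (n - #|W|).
Proof.
rewrite (bigID (mem W)) /=.
rewrite (eq_bigr (fun=> a)) ?prod_nat_const; last by move=> v ->.
rewrite (eq_bigr (fun => b)); last by move=> v /negPf->.
rewrite (eq_bigl (fun v => v \in ~: W)); last by move=> v; rewrite inE.
by rewrite prod_nat_const cardsCs setCK card_ord.
Qed.

Lemma sum_ord0_if (a b : nat) : \sum_(i < Q) (if i == ord0 then a else b) = a + q * b.
Proof.
rewrite big_ord_recl eqxx; congr addn.
by rewrite big_const_ord iter_addn_0 mulnC.
Qed.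

(** Exponential moment: a variable of [W] weighs [Q] if restricted and 1 otherwise, which has mean
    below 2 at density [1/Q]. *)
Lemma card_restricted_large W k :
  #|[set y : {ffun 'I_n -> letter} | k < 4 * #|W :&: restricted y|]| * Q ^ (k %/ 4) <= 2 ^ #|W| * (2 * Q) ^ n.
Proof.
apply: leq_trans (markov_card
  (w := fun y : {ffun 'I_n -> letter} => \prod_v (if (v \in W) && ((y v).2 == ord0) then Q else 1)) _) _.
  move=> y h; rewrite (eq_bigr (fun v => if v \in W :&: restricted y then Q else 1)).
    by rewrite prodn_mem exp1n muln1 leq_pexp2l //; lia.
  by move=> v _; rewrite !inE.
rewrite (sum_words (fun v a => if (v \in W) && (a.2 == ord0) then Q else 1)) /=.
apply: leq_trans (_ : \prod_(v < n) ((if v \in W then 2 else 1) * (2 * Q)) <= _).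
  apply: leq_prod => v _; rewrite big_bool /=; case: (v \in W) => /=.
    rewrite !sum_ord0_if; lia.
  rewrite !big_const_ord !iter_addn_0; lia.
by rewrite big_split /= prodn_mem exp1n muln1 prod_nat_const card_ord.
Qed.

(** Exponential moment of [2^(-hits)], with every factor doubled to stay integral. A variable of [C]
    is hit with probability at least [1/(2Q)], which lowers its factor from [4Q] to at most
    [4Q - 1]. *)
Lemma card_hits_small C s t : s <= #|vars C| ->
  #|[set y : {ffun 'I_n -> letter} | #|hits y C| <= t]| * (2 ^ n * (4 * Q) ^ s)
    <= 2 ^ t * ((4 * Q) ^ n * (4 * Q - 1) ^ s).
Proof.
move=> sC; rewrite mulnA.
have h1 : #|[set y : {ffun 'I_n -> letter} | #|hits y C| <= t]| * 2 ^ n <=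
   \sum_(y : {ffun 'I_n -> letter}) 2 ^ t * \prod_v (if ((y v).2 == ord0) && ((v, (y v).1) \in C) then 1 else 2).
  apply: markov_card => y h.
  rewrite (eq_bigr (fun v => if v \in hits y C then 1 else 2)); last first.
    by move=> v _; rewrite !inE.
  by rewrite prodn_mem exp1n mul1n -expnD leq_pexp2l //; lia.
apply: leq_trans (leq_mul h1 (leqnn _)) _.
rewrite -big_distrr /= -mulnA leq_mul2l; apply/orP; right.
rewrite (sum_words (fun v a => if (a.2 == ord0) && ((v, a.1) \in C) then 1 else 2)) /=.
apply: leq_trans (_ : \prod_v (if v \in vars C then 4 * Q - 1 else 4 * Q) * (4 * Q) ^ s <= _).
  rewrite leq_mul2r; apply/orP; right; apply: leq_prod => v _.
  have E b : \sum_(i < Q) (if (i == ord0) && ((v, b) \in C) then 1 else 2)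
     = 2 * Q - ((v, b) \in C).
    transitivity (\sum_(i < Q) (if i == ord0 then 2 - ((v, b) \in C) else 2)).
      by apply: eq_bigr => i _; case: (i == ord0); case: (_ \in C).
    by rewrite sum_ord0_if; case: (_ \in C) => /=; lia.
  rewrite big_bool /= !E; case: imsetP => [[[u b] /= uC ->]|_]; last by lia.
  by move: uC; case: b => -> /=; lia.
rewrite prodn_mem.
have Vn : #|vars C| <= n by have := max_card (mem (vars C)); rewrite card_ord.
rewrite -mulnA -expnD -[X in (4 * Q - 1) ^ X](subnKC sC) expnD -mulnA mulnC [leqRHS]mulnC.
rewrite mulnC leq_mul2l; apply/orP; right.
apply: leq_trans (_ : (4 * Q) ^ (#|vars C| - s) * (4 * Q) ^ (n - #|vars C| + s) <= _).
  by rewrite leq_mul2r leq_exp2r_le ?orbT //; lia.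
by rewrite -expnD leq_pexp2l //; lia.
Qed.

End Words.

Section Restriction.
Variables (n m k q : nat) (F : cnf n m).
Notation Q := q.+1.
Notation word := {ffun 'I_n -> bool * 'I_Q}.
Implicit Types (y : word) (C : clause n).

Hypothesis F_width : forall j, #|vars (F j)| <= k.

Definition heavy y : {set 'I_m} := [set j | k < 4 * #|vars (F j) :&: restricted y|].

Definition lightly_restricted y : {set 'I_n} :=
  restricted y :\: \bigcup_(j in heavy y) vars (F j).

Definition word_alive s y : pred (clause n) :=
  alive s F (lightly_restricted y) (fun v => (y v).1).

Lemma lightly_restrictedP y j : 4 * #|vars (F j) :&: lightly_restricted y| <= k.
Proof.
have [jH|jH] := boolP (j \in heavy y).
  have -> : vars (F j) :&: lightly_restricted y = finset.set0.
    apply/setP => v; rewrite !inE; case: (boolP (v \in vars (F j))) => //= vj.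
    by have /bigcupP -> : exists2 i, i \in heavy y & v \in vars (F i) by exists j.
  by rewrite cards0.
move: jH; rewrite inE -leqNgt; apply: leq_trans.
by rewrite leq_mul2l /= subset_leq_card // setIS // subsetDl.
Qed.

Lemma card_removed y : #|restricted y :\: lightly_restricted y| <= k * #|heavy y|.
Proof.
rewrite /lightly_restricted setDDr setDv set0U.
apply: leq_trans (subset_leq_card (subsetIr _ _)) _.
apply: leq_trans (_ : \sum_(j in heavy y) k <= _); last by rewrite sum_nat_const mulnC.
apply: leq_trans (_ : \sum_(j in heavy y) #|vars (F j)| <= _); last exact: leq_sum.
elim/big_rec2: _ => [|j N A _ IH]; first by rewrite cards0.
have [h _] := leq_card_setU (vars (F j)) A; by apply: leq_trans h _; rewrite leq_add2l.
Qed.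

(** No literal of an alive clause is satisfied at a variable that stays restricted, so all hits fall
    on released variables. *)
Lemma word_alive_hits s y C : word_alive s y C -> #|hits y C| <= k * #|heavy y|.
Proof.
move=> aC; apply: leq_trans (card_removed y); apply: subset_leq_card.
apply/subsetP => v; rewrite [v \in hits _ _]inE => /andP[vR vC].
rewrite in_setD vR andbT; apply: contraL vC => vU.
exact: alive_not_sat aC vU.
Qed.

(** Markov's inequality: the second hypothesis makes the mean of [k * #|heavy y|] at most
    [t / 2]. *)
Lemma card_not_good t : 0 < t -> 2 * (k * m * 2 ^ k) <= t * Q ^ (k %/ 4) ->
  2 * #|[set y : word | t < k * #|heavy y|]| <= (2 * Q) ^ n.
Proof.
move=> t_gt0 tQ.
have h1 : #|[set y : word | t < k * #|heavy y|]| * t <= \sum_(y : word) k * #|heavy y|.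
  by apply: markov_card => y /ltnW.
have h2 : (\sum_(y : word) #|heavy y|) * Q ^ (k %/ 4) <= m * (2 ^ k * (2 * Q) ^ n).
  have -> : \sum_(y : word) #|heavy y| = \sum_(j < m) #|[set y : word | k < 4 * #|vars (F j) :&: restricted y|]|.
    under eq_bigr => y _ do rewrite -sum1_card big_mkcond /=.
    rewrite exchange_big /=; apply: eq_bigr => j _.
    by rewrite -sum1_card [RHS]big_mkcond; apply: eq_bigr => y _; rewrite !inE.
  rewrite big_distrl -[X in _ <= X * _]card_ord -sum_nat_const; apply: leq_sum => j _.
  apply: leq_trans (card_restricted_large _ _ _) _.
  by rewrite leq_mul2r leq_pexp2l ?orbT.
rewrite -big_distrr /= in h1.
have Qk : 0 < t * Q ^ (k %/ 4) by rewrite muln_gt0 t_gt0 expn_gt0.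
rewrite -(leq_pmul2r Qk).
move: (\sum_y _) h1 h2 => S; move: (#|_|) (Q ^ _) (2 ^ k) ((2 * Q) ^ n) tQ => x P z N tQ h1 h2.
have h3 : x * t * P <= k * S * P by rewrite leq_mul2r h1 orbT.
have h4 : k * (S * P) <= k * (m * (z * N)) by rewrite leq_mul2l h2 orbT.
have h5 : 2 * (k * m * z) * N <= t * P * N by rewrite leq_mul2r tQ orbT.
lia.
Qed.

(** Such a clause expects at least [4 * t] hits, but has at most [t] when alive under these words.
    The fraction of words is at most [2^t * (1 - 1/(4Q))^(4Q * 2t) <= 2^(-t)]. *)
Lemma card_word_alive t s C : s = 8 * Q * t -> s < #|vars C| ->
  #|[set y : word | (k * #|heavy y| <= t) && word_alive s y C]| * 2 ^ t <= (2 * Q) ^ n.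
Proof.
move=> def_s sC; have h := card_hits_small q t (ltnW sC).
have sub : #|[set y : word | (k * #|heavy y| <= t) && word_alive s y C]| <=
    #|[set y : word | #|hits y C| <= t]|.
  apply: subset_leq_card; apply/subsetP => y; rewrite !inE => /andP[ht aC].
  exact: leq_trans (word_alive_hits aC) ht.
apply: leq_trans (leq_mul sub (leqnn _)) _.
have hB : 2 ^ (2 * t) * (4 * Q - 1) ^ s <= (4 * Q) ^ s.
  have -> : s = (4 * Q) * (2 * t) by lia.
  rewrite [X in _ * X <= _]expnM [leqRHS]expnM -expnMn leq_exp2r_le //.
  have := @double_expn_pred (4 * Q - 1) (4 * Q).
  have -> : (4 * Q - 1).+1 = 4 * Q by lia.
  by apply; lia.
have pos : 0 < 2 ^ n * (4 * Q) ^ s * 2 ^ t by rewrite !muln_gt0 !expn_gt0.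
rewrite -(leq_pmul2r pos).
have e4 : (4 * Q) ^ n = 2 ^ n * (2 * Q) ^ n by rewrite -expnMn mulnA.
have e2 : 2 ^ (2 * t) = 2 ^ t * 2 ^ t by rewrite mul2n -addnn expnD.
move: h hB; rewrite e4 e2.
move: (#|_|) (2 ^ n) ((4 * Q) ^ s) (2 ^ t) ((2 * Q) ^ n) ((_ - 1) ^ s) => x a b c N z h hB.
have h1 : x * (a * b) * (c * c) <= c * (a * N * z) * (c * c) by rewrite leq_mul2r h orbT.
have h2 : c * c * z * (c * (a * N)) <= b * (c * (a * N)) by rewrite leq_mul2r hB orbT.
lia.
Qed.

Theorem expanding_reduction l t :
    3 < k -> 0 < t <= n -> 2 * (k * m * 2 ^ k) <= t * Q ^ (k %/ 4) ->
    (forall A : {set 'I_m}, 0 < #|A| <= 16 * Q * t ->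
      3 * k * #|A| <= 4 * #|span (fun j => vars (F j)) A|) ->
    0 < l -> 4 * l <= 2 ^ t ->
  refuter_dt_reduces_to_rwphp l F 2.
Proof.
move=> k_gt3 /andP[t_gt0 tn] tQ F_expand l_gt0 lt.
pose s := 8 * Q * t.
have s_gt0 : 0 < s by rewrite !muln_gt0.
pose Y := {y : word | k * #|heavy y| <= t}.
have cardY : #|{: Y}| = #|[set y : word | k * #|heavy y| <= t]|.
  by rewrite card_sig; apply: eq_card => y; rewrite !inE.
have Y_large : (2 * Q) ^ n <= 2 * #|{: Y}|.
  have := card_not_good t_gt0 tQ.
  have -> : [set y : word | t < k * #|heavy y|] = ~: [set y : word | k * #|heavy y| <= t].
    by apply/setP => y; rewrite !inE ltnNge.
  rewrite cardsCs setCK card_ffun card_prod card_bool !card_ord -cardY; lia.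
have expand (A : {set 'I_m}) : 0 < #|A| <= 2 * s ->
    3 * k * #|A| <= 4 * #|span (fun j => vars (F j)) A|.
  by move=> hA; apply: F_expand; rewrite /s in hA; lia.
pose Y_alive (y : Y) := word_alive s (val y).
(* At least half of all words belong to [Y], and a wide clause is alive under at most a fraction
   [2^(-t)] of all words, so [4 * l <= 2^t] gives the factor 2 between codes and words. *)
have := @strategies_reduction n m l s ((2 * Q) ^ n %/ 2 ^ t) F Y Y_alive.
apply => //.
- rewrite divn_gt0 ?expn_gt0 //.
  apply: leq_trans (_ : 2 ^ n <= _); first by rewrite leq_pexp2l.
  by apply: leq_exp2r_le; lia.
- rewrite -(leq_pmul2l (isT : 0 < 2)); apply: leq_trans Y_large.
  apply: leq_trans (leq_divM ((2 * Q) ^ n) (2 ^ t)).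
  move: (_ %/ _) => K; nia.
- by move=> y; apply: (alive_nil (k := k)) => //; exact: lightly_restrictedP.
- by move=> y C D; exact: aliveS.
- by move=> y C j; exact: alive_axiom.
- by move=> y C z; apply: (alive_extend (k := k)) => //; exact: lightly_restrictedP.
- move=> C sC; rewrite leq_divRL ?expn_gt0 //.
  apply: leq_trans (card_word_alive (erefl s) sC); rewrite leq_mul2r; apply/orP; right.
  rewrite -(card_imset _ val_inj); apply: subset_leq_card; apply/subsetP => y.
  by case/imsetP => -[y' hy'] /=; rewrite !inE /= => aC ->; rewrite hy'.
Qed.

End Restriction.

(** * Expansion of random formulas *)

Section RandomCnf.
Variables (k n m : nat).
Notation T := ('C(n, k) * 2 ^ k).
Implicit Types (phi : cnf n m) (C : clause n) (A : {set 'I_m}) (W V : {set 'I_n}).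

Lemma ordinary_card_vars C : ordinary_kclause k C -> #|vars C| = k.
Proof.
case/andP => /eqP <- /forallP no_both; apply: card_in_imset => -[u b] [u' b'] /= uC uC' e.
move: uC'; rewrite -e => uC'; congr pair.
by have := no_both u; case: b uC; case: b' uC' => // -> ->.
Qed.

(** An ordinary clause is encoded by its variable set and the subset of positive variables; this is
    injective as no variable has both signs. *)
Lemma card_ordinary W :
  #|[set C : clause n | ordinary_kclause k C && (vars C \subset W)]| <= 'C(#|W|, k) * 2 ^ k.
Proof.
pose f C := (vars C, [set v | (v, true) \in C]).
have f_inj : {in [set C : clause n | ordinary_kclause k C && (vars C \subset W)] &, injective f}.
  suff memf C v b : ordinary_kclause k C ->
      ((v, b) \in C) = (v \in (f C).1) && (b == (v \in (f C).2)).
    move=> C D; rewrite !inE => /andP[oC _] /andP[oD _] eCD.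
    by apply/setP => -[v b]; rewrite !memf // eCD.
  case/andP => _ /forallP/(_ v) no_both; rewrite /= inE.
  apply/idP/andP => [vC|[/imsetP[[u b'] /= uC ->] /eqP->]].
    by split; [exact: mem_vars vC|case: b vC no_both => -> //=; case: (_ \in C)].
  by case: b' uC; [move=> h; rewrite h|case: (boolP ((u, true) \in C))].
rewrite -(card_in_imset f_inj).
pose S := [set V : {set 'I_n} | V \subset W & #|V| == k].
apply: leq_trans (_ : \sum_(V in S) \sum_(B in powerset V) 1 <= _); last first.
  rewrite (eq_bigr (fun=> 2 ^ k)); first by rewrite sum_nat_const cards_draws.
  by move=> V; rewrite inE => /andP[_ /eqP <-]; rewrite sum1_card card_powerset.
rewrite pair_big_dep /= sum1_card; apply: subset_leq_card; apply/subsetP => p.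
case/imsetP => C; rewrite inE => /andP[oC CW] ->.
rewrite unfold_in /= !inE CW ordinary_card_vars // eqxx /=.
by apply/subsetP => v; rewrite inE; exact: mem_vars.
Qed.

Lemma card_kcnf_within A W :
  #|[set phi : cnf n m | is_kcnf k phi & [forall j in A, vars (phi j) \subset W]]|
    <= ('C(#|W|, k) * 2 ^ k) ^ #|A| * T ^ (m - #|A|).
Proof.
pose Q (j : 'I_m) : pred (clause n) :=
  fun C => ordinary_kclause k C && ((j \in A) ==> (vars C \subset W)).
apply: leq_trans (_ : \sum_(phi in family Q) \prod_(j < m) 1 <= _).
  rewrite (eq_bigr (fun=> 1)) ?sum1_card; last by move=> phi _; rewrite big1.
  apply: subset_leq_card; apply/subsetP => phi; rewrite inE.
  case/andP => /forallP kphi /forall_inP wphi; apply/familyP => j.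
  by rewrite unfold_in kphi /=; apply/implyP => /wphi.
rewrite -(bigA_distr_big_dep Q (fun _ _ => 1)).
rewrite -prodn_mem; apply: leq_prod => j _; rewrite sum1_card -cardsE.
case: ifP => jA.
  apply: leq_trans (card_ordinary W); apply: subset_leq_card; apply/subsetP => C.
  by rewrite !inE unfold_in.
rewrite -[X in 'C(X, k)](card_ord n) -cardsT.
apply: leq_trans (card_ordinary _); apply: subset_leq_card; apply/subsetP => C.
by rewrite !inE unfold_in subsetT andbT.
Qed.

(** The ratio [3/4] lies above the [1/2] that forces a boundary, and below 1 by enough for the first
    moment to be small. *)
Definition expanding r phi := [forall A : {set 'I_m},
  (0 < #|A| <= r) ==> (3 * k * #|A| <= 4 * #|span (fun j => vars (phi j)) A|)].

Lemma extend_card V u : #|V| <= u <= n -> exists W, V \subset W /\ #|W| = u.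
Proof.
case/andP; move: {2}(u - #|V|) (erefl (u - #|V|)) => d.
elim: d V => [|d IH] V e Vu un; first by exists V; split=> //; lia.
have /card_gt0P[v] : 0 < #|~: V| by have := cardsC V; rewrite card_ord; lia.
rewrite inE => vV; have cardVv : #|v |: V| = #|V|.+1 by rewrite cardsU1 vV.
have [|||W [VW cW]] := IH (v |: V); try by rewrite ?cardVv; lia.
by exists W; split=> //; apply: subset_trans VW; exact: subsetUr.
Qed.

Lemma sum_by_card r (g : nat -> nat) :
  \sum_(A : {set 'I_m} | 0 < #|A| <= r) g #|A| = \sum_(1 <= a < r.+1) 'C(m, a) * g a.
Proof.
rewrite [RHS](eq_bigr (fun a => \sum_(A : {set 'I_m} | #|A| == a) g #|A|)); last first.
  move=> a _; rewrite (eq_bigr (fun=> g a)); last by move=> A /eqP->.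
  by rewrite sum_nat_const -cardsE card_draws card_ord.
rewrite (exchange_big_dep xpredT) //= big_mkcond /=; apply: eq_bigr => A _.
by rewrite (eq_bigl (fun a => a == #|A|)) ?big_nat1_eq // => a; rewrite eq_sym.
Qed.

(** Union bound over the violating set [A] and a set [W] of size exactly [3 * k * #|A| %/ 4] around
    its variables; the hypothesis ensures that such a [W] fits into the [n] variables. *)
Lemma card_nonexpanding_sum r : 3 * k * r <= 4 * n ->
  #|[set phi | is_kcnf k phi && ~~ expanding r phi]| <=
    \sum_(1 <= a < r.+1) 'C(m, a) * ('C(n, 3 * k * a %/ 4) *
      (('C(3 * k * a %/ 4, k) * 2 ^ k) ^ a * T ^ (m - a))).
Proof.
move=> rn.
rewrite -(sum_by_card r (fun a => 'C(n, 3 * k * a %/ 4) *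
      (('C(3 * k * a %/ 4, k) * 2 ^ k) ^ a * T ^ (m - a)))).
pose within A W phi := is_kcnf k phi && [forall j in A, vars (phi j) \subset W].
apply: leq_trans (_ : \sum_(A : {set 'I_m} | 0 < #|A| <= r)
  \sum_(W : {set 'I_n} | #|W| == 3 * k * #|A| %/ 4) #|[set phi | within A W phi]| <= _).
  apply: leq_trans (_ : \sum_(phi : cnf n m) \sum_(A : {set 'I_m} | 0 < #|A| <= r)
    \sum_(W : {set 'I_n} | #|W| == 3 * k * #|A| %/ 4) within A W phi <= _); last first.
    rewrite exchange_big; apply: leq_sum => A _.
    rewrite exchange_big; apply: leq_sum => W _ /=.
    by rewrite -sum1_card [leqRHS]big_mkcond /=; apply: leq_sum => phi _; rewrite inE.
  rewrite -[X in X <= _]muln1; apply: markov_card => phi /andP[kphi /forallPn[A]].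
  rewrite negb_imply -ltnNge => /andP[hA small].
  have [|W [VW /eqP cW]] :=
      extend_card (V := span (fun j => vars (phi j)) A) (u := 3 * k * #|A| %/ 4).
    have : 3 * k * #|A| <= 3 * k * r by rewrite leq_mul2l; case/andP: hA => _ ->; rewrite orbT.
    move: small rn; set x := 3 * k * #|A|; set z := 3 * k * r; set b := #|_|; clearbody x z b; lia.
  rewrite (bigD1 A) //= (bigD1 W) //= /within kphi /=.
  have -> : [forall j in A, vars (phi j) \subset W].
    by apply/forall_inP => j jA; apply: subset_trans VW; rewrite /span; exact: (bigcup_sup j).
  by rewrite -addnA.
apply: leq_sum => A hA.
apply: leq_trans (_ : \sum_(W : {set 'I_n} | #|W| == 3 * k * #|A| %/ 4)
   (('C(3 * k * #|A| %/ 4, k) * 2 ^ k) ^ #|A| * T ^ (m - #|A|)) <= _).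
  by apply: leq_sum => W /eqP <-; exact: card_kcnf_within.
by rewrite sum_nat_const -cardsE card_draws card_ord.
Qed.

End RandomCnf.

(** * Binomial estimates and the first moment *)

(** The usual bound [(e * n / u)^u] with 4 for [e], from [u^u <= 'C(2 * u, u) * u! <= 4^u * u!]. *)
Lemma leq_bin_expn n u : 'C(n, u) * u ^ u <= (4 * n) ^ u.
Proof.
have h1 : u ^ u <= 'C(2 * u, u) * u`!.
  rewrite bin_ffact ffact_prod -[X in _ ^ X <= _]card_ord -prod_nat_const.
  by apply: leq_prod => i _; have := ltn_ord i; lia.
have h2 : 'C(2 * u, u) <= 4 ^ u.
  rewrite (_ : 4 ^ u = 2 ^ (2 * u)); last by rewrite expnM.
  rewrite -[in leqRHS](card_ord (2 * u)) -cardsT -card_powerset.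
  rewrite -[X in 'C(X, u)]card_ord -card_draws; apply: subset_leq_card.
  by apply/subsetP => V _; rewrite inE subsetT.
have h3 : 'C(n, u) * u`! <= n ^ u.
  rewrite bin_ffact ffact_prod -[X in _ <= _ ^ X]card_ord -prod_nat_const.
  by apply: leq_prod => i _; exact: leq_subr.
rewrite expnMn; apply: leq_trans (_ : 'C(n, u) * (4 ^ u * u`!) <= _).
  by rewrite leq_mul2l (leq_trans h1) ?orbT // leq_mul2r h2 orbT.
by rewrite mulnCA leq_mul2l h3 orbT.
Qed.

(** Factor by factor, [(u - i) / (n - i) <= u / n]. *)
Lemma leq_bin_ratio u n k : u <= n -> 'C(u, k) * n ^ k <= 'C(n, k) * u ^ k.
Proof.
move=> un; rewrite -(leq_pmul2r (fact_gt0 k)) mulnAC bin_ffact mulnAC bin_ffact.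
have expn_prod x : x ^ k = \prod_(i < k) x by rewrite prod_nat_const card_ord.
rewrite !ffact_prod !expn_prod -!big_split /=.
by apply: leq_prod => i _; rewrite !mulnBl (mulnC n u) leq_sub2l // leq_mul2l un orbT.
Qed.

Lemma cube_leq_expn2 a : 0 < a -> a ^ 3 <= 8 * 2 ^ a.-1.
Proof.
case: a => // a _ /=; elim: a => [//|a IH].
have [a_small|a_large] := ltnP a 4; first by move: a_small {IH}; case: a => [|[|[|[|a]]]].
rewrite [2 ^ _]expnS; apply: leq_trans (_ : 2 * a.+1 ^ 3 <= _); last by lia.
rewrite !expnS !expn0; nia.
Qed.

(* The first moment of the small vertex sets spanning too many clauses: the
   [a]-th term decays like [(a / n) ^ (3 * a)] because each variable set of
   size [3 * k * a %/ 4] has to contain [a] clauses, and [k - 3 * k / 4 >= 4]. *)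
Lemma first_moment_term (c k n m a : nat) (B := 4 * c * 4 ^ k * k ^ 4) :
    15 < k -> m <= c * n -> 0 < a -> 2 * B * a <= n -> k * a <= n ->
  'C(m, a) * ('C(n, 3 * k * a %/ 4) * 'C(3 * k * a %/ 4, k) ^ a) * n ^ 3
    <= 8 * B * 'C(n, k) ^ a.
Proof.
move=> k_gt15 mn a_gt0 aB ka; set u := _ %/ 4.
have u_gt0 : 0 < u by rewrite divn_gt0 //; nia.
have uka : u <= k * a by rewrite /u; lia.
have un : u <= n := leq_trans uka ka.
have n_gt0 : 0 < n := leq_trans u_gt0 un.
have exps : u + 4 * a <= k * a.
  by rewrite /u; have : 16 * a <= k * a by [rewrite leq_mul2r k_gt15 orbT]; lia.
have h1 : 'C(m, a) * a ^ a <= (4 * c * n) ^ a.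
  by apply: leq_trans (leq_bin_expn _ _) _; apply: leq_exp2r_le; lia.
have h2 := leq_bin_expn n u.
have h3 : 'C(u, k) ^ a * n ^ (k * a) <= 'C(n, k) ^ a * u ^ (k * a).
  by rewrite !expnM -!expnMn; apply: leq_exp2r_le; exact: leq_bin_ratio.
set X1 := 'C(m, a) in h1 *; set X2 := 'C(n, u) in h2 *; set X3 := 'C(u, k) ^ a in h3 *.
set Y := 'C(n, k) ^ a in h3 *.
set r := k * a - u - 4 * a.
have def_ka : k * a = u + (4 * a + r) by rewrite /r; lia.
have h4 : X1 * (X2 * X3) * (a ^ a * u ^ u * n ^ (k * a))
    <= (4 * c * n) ^ a * ((4 * n) ^ u * (Y * u ^ (k * a))).
  apply: leq_trans (leq_mul h1 (leq_mul h2 h3)).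
  by move: (a ^ a) (u ^ u) (n ^ _) => p1 p2 p3; clear; lia.
(* Of the [k * a] powers of [n] on the left, [u] pay for choosing the variables, [a] for choosing
   the clauses and [r] absorb [u ^ r]; [3 * a] remain. *)
have h5 : X1 * (X2 * X3) * (a ^ a * n ^ (3 * a)) <= (4 * c) ^ a * 4 ^ u * (Y * u ^ (4 * a)).
  have pos : 0 < u ^ u * n ^ (u + a + r) by rewrite muln_gt0 !expn_gt0 u_gt0 n_gt0.
  rewrite -(leq_pmul2r pos).
  have ur : u ^ r <= n ^ r by apply: leq_exp2r_le.
  have e1 : n ^ (k * a) = n ^ (3 * a) * n ^ (u + a + r) by rewrite -expnD def_ka; congr (_ ^ _); lia.
  have e2 : u ^ (k * a) = u ^ u * u ^ (4 * a) * u ^ r by rewrite -!expnD def_ka; congr (_ ^ _); lia.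
  move: h4; rewrite e1 e2 !(expnMn _ n) (expnD _ _ r) (expnD _ u).
  move: (X1 * _) (a ^ a) (u ^ u) (n ^ (3 * a)) (n ^ u) (n ^ a) (n ^ r) (u ^ (4 * a)) (u ^ r)
    ((4 * c) ^ a) (4 ^ u) ur => Z p1 p2 p3 p4 p5 p6 p7 p8 p9 p10 ur h4.
  have h := leq_mul (leqnn (p9 * p10 * Y * p7 * p2 * p4 * p5)) ur.
  by clear -h h4; lia.
have h6 : X1 * (X2 * X3) * n ^ (3 * a) <= (B * a ^ 3) ^ a * Y.
  have pos : 0 < a ^ a by rewrite expn_gt0 a_gt0.
  rewrite -(leq_pmul2r pos).
  have ua : u ^ (4 * a) <= (k ^ 4) ^ a * (a ^ a * (a ^ 3) ^ a).
    have -> : (k ^ 4) ^ a * (a ^ a * (a ^ 3) ^ a) = (k * a) ^ (4 * a).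
      by rewrite expnM (expnMn k) (expnS a 3) !expnMn.
    exact: leq_exp2r_le.
  have u4 : 4 ^ u <= (4 ^ k) ^ a by rewrite -expnM leq_pexp2l.
  rewrite /B (expnMn _ (a ^ 3)) (expnMn _ (k ^ 4)) (expnMn (4 * c)).
  move: (a ^ a) (n ^ _) ((4 * c) ^ a) (4 ^ u) ((4 ^ k) ^ a) ((k ^ 4) ^ a) ((a ^ 3) ^ a) (u ^ _)
    u4 ua h5 => p1 p2 p3 p4 p5 p6 p7 p8 u4 ua h5.
  have h := leq_mul (leqnn (p3 * Y)) (leq_mul u4 ua).
  by clear -h h5; lia.
have h7 : 2 * (B * a ^ 3) <= n ^ 3.
  apply: leq_trans (_ : (2 * B * a) ^ 3 <= _); last exact: leq_exp2r_le.
  rewrite expnMn mulnA leq_mul2r; apply/orP; right.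
  by case: (posnP (2 * B)) => [->//|h]; rewrite -[leqLHS]expn1 leq_pexp2l.
(* By [h7], all but one of the [a] factors [B * a ^ 3] are at most [n ^ 3 / 2]. The geometric gain
   then absorbs the last [a ^ 3], and one [n ^ 3] is kept for the conclusion. *)
have h8 : (B * a ^ 3) ^ a * 2 ^ a.-1 <= B * a ^ 3 * (n ^ 3) ^ a.-1.
  have -> : (B * a ^ 3) ^ a = B * a ^ 3 * (B * a ^ 3) ^ a.-1 by rewrite -expnS prednK.
  rewrite -mulnA -expnMn leq_mul2l; apply/orP; right; apply: leq_exp2r_le.
  by rewrite mulnC.
have h9 := cube_leq_expn2 a_gt0.
have pos : 0 < (n ^ 3) ^ a.-1 * 2 ^ a.-1 by rewrite muln_gt0 !expn_gt0 n_gt0.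
rewrite -(leq_pmul2r pos).
have e3 : n ^ (3 * a) = n ^ 3 * (n ^ 3) ^ a.-1 by rewrite -expnS prednK // -expnM.
rewrite e3 in h6.
move: (X1 * _) h6 h8 h9 => Z; move: (n ^ 3) ((n ^ 3) ^ a.-1) (2 ^ a.-1) (a ^ 3) (_ ^ a) => N3 N P a3 Ba h6 h8 h9.
have i1 : Z * (N3 * N) * P <= Ba * Y * P by rewrite leq_mul2r h6 orbT.
have i2 : Ba * P * Y <= B * a3 * N * Y by rewrite leq_mul2r h8 orbT.
have i3 : a3 * (B * N * Y) <= 8 * P * (B * N * Y) by rewrite leq_mul2r h9 orbT.
by clear -i1 i2 i3; lia.
Qed.

(** At most [n] terms, each a fraction [O(1/n^3)] of all formulas, give the summable rate
    [O(1/n^2)]. *)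
Lemma card_nonexpanding (c k n m r : nat) (B := 4 * c * 4 ^ k * k ^ 4) :
    15 < k -> m <= c * n -> 2 * B * r <= n -> k * r <= n ->
  #|[set phi : cnf n m | is_kcnf k phi && ~~ expanding k r phi]| * n ^ 2
    <= 8 * B * ('C(n, k) * 2 ^ k) ^ m.
Proof.
move=> k_gt15 mn rB kr.
have rn : r <= n by apply: leq_trans kr; rewrite leq_pmull //; lia.
have [->|n_gt0] := posnP n; first by rewrite muln0.
rewrite -(leq_pmul2r n_gt0) -mulnA -expnSr.
apply: leq_trans (leq_mul (card_nonexpanding_sum _ _) (leqnn _)) _; first by lia.
rewrite big_distrl /=.
apply: leq_trans (_ : \sum_(1 <= a < r.+1) 8 * B * ('C(n, k) * 2 ^ k) ^ m <= _); last first.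
  by rewrite sum_nat_const_nat mulnC leq_mul2l subn1 /= rn orbT.
rewrite big_nat_cond [leqRHS]big_nat_cond; apply: leq_sum => a /andP[/andP[a_gt0 ar] _].
have [am|ma] := leqP a m; last by rewrite bin_small.
have h := @first_moment_term c k n m a k_gt15 mn a_gt0.
have {}h : 'C(m, a) * ('C(n, 3 * k * a %/ 4) * 'C(3 * k * a %/ 4, k) ^ a) * n ^ 3
    <= 8 * B * 'C(n, k) ^ a.
  by apply: h; [apply: leq_trans rB|apply: leq_trans kr]; rewrite leq_mul2l; lia.
rewrite -[in leqRHS](subnKC am) expnD !expnMn.
move: (_ ^ (m - a)) (_ ^ a) (n ^ 3) => X Y Z in h *.
move: 'C(m, a) 'C(n, _) ('C(n, k) ^ a) ((2 ^ k) ^ a) ((2 ^ k) ^ (m - a)) h => p1 p2 p3 p4 p5 h.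
have h' := leq_mul h (leqnn (p4 * (X * p5))).
by clear -h'; lia.
Qed.

(** * Choice of the constants *)

Section Scales.
Variables (c k : nat).

(* A first-moment computation makes random formulas expand up to
   [n / (2 * expansion_scale)] clauses; [letters] makes the restrictions so sparse that
   the variables released for the sake of heavy clauses number at most [n / gap],
   which is small compared to the restricted part of a wide clause. *)
Definition expansion_scale := 4 * c * 4 ^ k * k ^ 4.
Definition letters := 128 * k * c * 2 ^ k * expansion_scale.
Definition gap := 32 * letters.+1 * expansion_scale.
Definition expansion_size n := 16 * letters.+1 * (n %/ gap).

Lemma expansion_size_le n : 2 * expansion_scale * expansion_size n <= n.
Proof.
apply: leq_trans (leq_divM n gap); rewrite /gap /expansion_size.
by move: (n %/ _) => t; lia.
Qed.

Hypotheses (c_gt0 : 0 < c) (k_gt15 : 15 < k).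

Lemma k_le_scale : k <= expansion_scale.
Proof.
rewrite /expansion_scale expnS.
have h : 0 < 4 * c * 4 ^ k * k ^ 3 by rewrite !muln_gt0 !expn_gt0 c_gt0; lia.
by rewrite mulnCA leq_pmulr.
Qed.

Lemma gap_gt0 : 0 < gap.
Proof. by have := k_le_scale; rewrite /gap; case: expansion_scale => //; lia. Qed.

Lemma kcnf_reduction (n m l : nat) (phi : cnf n m) :
    m <= c * n -> gap <= n -> is_kcnf k phi -> expanding k (expansion_size n) phi ->
    0 < l -> 4 * l <= 2 ^ (n %/ gap) ->
  refuter_dt_reduces_to_rwphp l phi 2.
Proof.
move=> mn gap_n /forallP kphi /forallP expphi l_gt0 lt.
have t_gt0 : 0 < n %/ gap by rewrite divn_gt0 // gap_gt0.
apply: (@expanding_reduction n m k letters phi _ l (n %/ gap)) => //.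
- by move=> j; rewrite (ordinary_card_vars (kphi j)).
- by lia.
- by rewrite t_gt0 leq_div.
- have n_le : n <= 2 * gap * (n %/ gap).
    by have := ltn_ceil n gap_gt0; nia.
  (* One factor [letters.+1] matches the one in [gap]; the other dominates the remaining constants,
     with [128 = 2 * 2 * 32]. *)
  have h4 : letters.+1 ^ 2 <= letters.+1 ^ (k %/ 4) by rewrite leq_pexp2l //; lia.
  apply: leq_trans (leq_mul (leqnn _) h4).
  have h1 : m <= c * (2 * gap * (n %/ gap)) by apply: leq_trans mn _; rewrite leq_mul2l n_le orbT.
  move: (n %/ gap) h1 => t h1.
  apply: leq_trans (_ : 2 * (k * (c * (2 * gap * t)) * 2 ^ k) <= _).
    by rewrite leq_mul2l leq_mul2r leq_mul2l h1 !orbT.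
  rewrite /gap; have : 128 * k * c * 2 ^ k * expansion_scale <= letters.+1 := leqnSn _.
  move: letters.+1 expansion_scale (2 ^ k) => Q E K hQ.
  have h := leq_mul hQ (leqnn (t * Q)).
  by rewrite expnS expn1; clear -h; lia.
- by move=> A hA; move/implyP: (expphi A); apply.
Qed.

Lemma card_nonexpanding_scaled (n m : nat) : m <= c * n ->
  #|[pred phi : cnf n m | is_kcnf k phi && ~~ expanding k (expansion_size n) phi]| * n ^ 2
    <= 8 * expansion_scale * ('C(n, k) * 2 ^ k) ^ m.
Proof.
move=> mn; rewrite -cardsE; apply: card_nonexpanding => //.
  exact: expansion_size_le.
apply: leq_trans (expansion_size_le n); rewrite leq_mul2r; apply/orP; right.
by apply: leq_trans k_le_scale _; rewrite leq_pmull.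
Qed.

End Scales.

(* Probability and the growth rate *)
From mathcomp Require Import all_order all_algebra.
From mathcomp Require Import all_classical all_reals all_analysis.
From mathcomp Require Import ring lra.
Import Order.TTheory GRing.Theory Num.Theory.
Local Open Scope ring_scope.
Local Open Scope classical_set_scope.

Lemma measurable_preimage_fin d (Omega : measurableType d) (T : finType) (X : Omega -> T)
    (A : pred T) :
  (forall x, measurable (X @^-1` [set x])) -> measurable (X @^-1` [set x | A x]).
Proof.
move=> mX; have -> : X @^-1` [set x | A x] = \big[setU/set0]_(x <- enum A) (X @^-1` [set x]).
  rewrite -bigcup_seq; apply/seteqP; split=> w /=.
    by move=> Aw; exists (X w) => //=; rewrite mem_enum.
  by case=> x /=; rewrite mem_enum => Ax ->.
by apply: bigsetU_measurable => x _; exact: mX.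
Qed.

Lemma measure_preimage_fin d (Omega : measurableType d) (R : realType)
    (P : {measure set Omega -> \bar R}) (T : finType) (X : Omega -> T) (A : pred T) :
  (forall x, measurable (X @^-1` [set x])) ->
  (P (X @^-1` [set x | A x]) <= \sum_(x | A x) P (X @^-1` [set x]))%E.
Proof.
move=> mX; rewrite -big_filter.
have -> : X @^-1` [set x | A x] = \big[setU/set0]_(x <- [seq x <- index_enum T | A x]) (X @^-1` [set x]).
  rewrite -bigcup_seq; apply/seteqP; split=> w /=.
    by move=> Aw; exists (X w) => //=; rewrite mem_filter mem_index_enum andbT.
  by case=> x /=; rewrite mem_filter => /andP[Ax _] ->.
elim: [seq x <- index_enum T | A x] => [|x s IH]; first by rewrite !big_nil measure0.
rewrite !big_cons; apply: le_trans (measureU2 _ _ _) _ => //.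
  by apply: bigsetU_measurable => y _; exact: mX.
by rewrite leeD2l.
Qed.

Lemma borel_cantelli_inv_square d (Omega : measurableType d) (R : realType)
    (P : {measure set Omega -> \bar R}) (E : nat -> set Omega) (K : R) (N : nat) :
    0 <= K -> (forall n, measurable (E n)) ->
    (forall n, (N <= n)%N -> (0 < n)%N -> (P (E n) <= (K / n%:R ^+ 2)%:E)%E) ->
  {ae P, forall w, exists N0 : nat, forall n : nat, (N0 <= n)%N -> ~ E n w}.
Proof.
(* The shift puts every index in the range of [PE] and makes each square at least
   [(n + 1) * (n + 2)], so the partial sums telescope to at most [K * (1 - 1/(n + 1))]. *)
move=> K0 mE PE; pose E' n := E (n + N.+2)%N.
have h : P (lim_sup_set E') = 0%E.
  apply: lim_sup_set_cvg0; first by move=> n; exact: mE.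
  apply: (@le_lt_trans _ _ K%:E); last by rewrite ltry.
  apply: lime_le; first by apply: is_cvg_nneseries => n _ _; exact: measure_ge0.
  apply: nearW => n; apply: (@le_trans _ _ (K * (1 - n.+1%:R^-1))%:E); last first.
    by rewrite lee_fin ler_piMr // lerBlDr lerDl invr_ge0.
  elim: n => [|n IH]; first by rewrite big_geq // invr1 subrr mulr0.
  rewrite big_nat_recr //=; apply: le_trans (leeD IH (PE _ _ _)) _; try lia.
  rewrite -EFinD lee_fin -mulrDr ler_wpM2l //.
  have n1 : 0 < n.+1%:R :> R by rewrite ltr0n.
  have h1 : ((n + N.+2)%:R ^+ 2 : R)^-1 <= (n.+1%:R * n.+2%:R)^-1.
    rewrite lef_pV2 ?posrE ?exprn_gt0 ?mulr_gt0 ?ltr0n ?addnS //.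
    by rewrite -natrX -natrM ler_nat; nia.
  have h2 : (n.+1%:R * n.+2%:R)^-1 = n.+1%:R^-1 - n.+2%:R^-1 :> R.
    have -> : n.+2%:R = n.+1%:R + 1 :> R by rewrite -natr1.
    by field; apply/andP; split; apply/eqP; lra.
  by rewrite -addrA lerD2l -lerBrDl opprK addrC (le_trans h1) // h2 addrC.
exists (lim_sup_set E'); split=> //.
  apply: bigcap_measurable => // i _; apply: bigcup_measurable => j _; exact: mE.
move=> w /= nw i _; apply: contrapT => nE; apply: nw; exists (i + N.+2)%N => n ni Enw.
apply: nE; exists (n - N.+2)%N => /=; first by lia.
by rewrite /E' subnK //; lia.
Qed.

Lemma bound_of_exp_growth (R : realType) (D n l : nat) : (0 < D)%N -> (5 * D <= n)%N ->
  l%:R < (1 + (4 * D)%:R^-1 : R) ^+ n -> (4 * l <= 2 ^ (n %/ D))%N.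
Proof.
move=> D0 nD; set x : R := (4 * D)%:R^-1 => lx.
have D4 : 0 < (4 * D)%:R :> R by rewrite ltr0n; lia.
have x0 : 0 < x by rewrite invr_gt0.
have x1 : x <= 1 by rewrite invf_le1 // -[1]/(1%:R) ler_nat; lia.
have xD : x * D%:R = 4^-1.
  by rewrite /x natrM invfM mulfVK // pnatr_eq0 -lt0n.
(* Since [(1 + x) * (1 - x) <= 1], it suffices that [(1 - x)^(2D) >= 1 - 2 * D * x = 1/2], by
   Bernoulli. *)
have h1 : (1 + x) ^+ (2 * D) <= 2.
  have bern j : 1 - j%:R * x <= (1 - x) ^+ j.
    elim: j => [|j IH]; first by rewrite mul0r subr0 expr0.
    have x1' : 0 <= 1 - x by rewrite subr_ge0.
    rewrite exprS; apply: le_trans (ler_wpM2l x1' IH).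
    have j0 : 0 <= j%:R :> R by [].
    by rewrite -natr1; nra.
  have h : (1 + x) ^+ (2 * D) * (1 - x) ^+ (2 * D) <= 1.
    by rewrite -exprMn exprn_ile1 //; [apply: mulr_ge0; lra|nra].
  have := bern (2 * D)%N; rewrite natrM -mulrA [D%:R * _]mulrC xD => b.
  have p : 0 < (1 + x) ^+ (2 * D) by rewrite exprn_gt0 // addr_gt0.
  nra.
have l2 : (l * l <= 2 ^ (n %/ D).+1)%N.
  rewrite -(ler_nat R) natrM natrX.
  apply: le_trans (_ : (1 + x) ^+ n * (1 + x) ^+ n <= _).
    by apply: ler_pM => //; exact: ltW.
  rewrite -exprD; apply: le_trans (_ : (1 + x) ^+ (2 * D * (n %/ D).+1) <= _).
    by apply: ler_weXn2l; [lra | have := ltn_ceil n D0; lia].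
  by rewrite exprM; apply: lerXn2r; rewrite ?nnegrE // exprn_ge0 //; lra.
(* From 5 on, [t + 1 <= 2 * (t - 2)], so [l2] yields [l <= 2 ^ (t - 2)] on taking square roots. *)
have t5 : (5 <= n %/ D)%N by rewrite leq_divRL.
move: (n %/ D)%N t5 l2 => t t5 l2.
suff : (l <= 2 ^ (t - 2))%N.
  by move=> h; rewrite -(subnK (_ : 2 <= t)%N) ?expnD; lia.
rewrite -leq_sqr; apply: leq_trans (_ : l * l <= _)%N; first by rewrite mulnn.
apply: leq_trans l2 _; rewrite -expnM leq_pexp2l //; lia.
Qed.

Theorem theorem5p10 (R : realType) :
  exists k0 : nat, forall k : nat, (0 < k)%N -> (k0 <= k)%N ->
  forall c : R, (7%:R / 10%:R) * 2%:R ^+ k <= c ->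
  exists eps : R, 0 < eps /\
  forall (d : measure_display) (Omega : measurableType d) (P : probability Omega R)
         (F : forall n : nat, Omega -> cnf n (num_clauses c n)),
    (forall n (phi : cnf n (num_clauses c n)), measurable (F n @^-1` [set phi])) ->
    mutually_independent P F ->
    (forall n, (k <= n)%N -> forall phi : cnf n (num_clauses c n),
        P (F n @^-1` [set phi]) =
        ((is_kcnf k phi)%:R / (('C(n, k) * 2 ^ k) ^ num_clauses c n)%:R)%:E) ->
    {ae P, forall w, exists N0 : nat, forall n : nat, (N0 <= n)%N ->
        refuter_reduces_bd ((1 + eps) ^+ n) (F n w) 2}.
Proof.
(* From 16 on, [k - 3 * k / 4 >= 4], as the first moment requires. *)
exists 16%N => k _ k_gt15 c c_large.
have c_ge0 : 0 <= c by apply: le_trans c_large; rewrite mulr_ge0 ?exprn_ge0 ?divr_ge0.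
pose C := (Num.truncn c).+1.
have clauses_le n : (num_clauses c n <= C * n)%N.
  rewrite /num_clauses -(ler_nat R); apply: (@le_trans _ _ (c * n%:R)).
    by rewrite truncn_le mulr_ge0.
  by rewrite natrM ler_wpM2r // ltW // truncnS_gt.
pose D := gap C k.
have D_gt0 : (0 < D)%N by exact: gap_gt0.
exists (4 * D)%:R^-1; split; first by rewrite invr_gt0 ltr0n; lia.
move=> d Omega P F mF _ PF.
pose good n := [pred phi : cnf n (num_clauses c n) |
  is_kcnf k phi && expanding k (expansion_size C k n) phi].
pose E n := F n @^-1` [set phi | ~~ good n phi].
have mE n : measurable (E n) by apply: measurable_preimage_fin => phi; exact: mF.
pose K : R := (8 * expansion_scale C k)%:R.
have PE n : (k <= n)%N -> (0 < n)%N -> (P (E n) <= (K / n%:R ^+ 2)%:E)%E.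
  move=> kn n_gt0; apply: le_trans (measure_preimage_fin _ _ (mF n)) _.
  set T := (('C(n, k) * 2 ^ k) ^ num_clauses c n)%N.
  have T_gt0 : 0 < T%:R :> R by rewrite ltr0n !expn_gt0 muln_gt0 bin_gt0 kn expn_gt0.
  rewrite (eq_bigr (fun phi => ((is_kcnf k phi)%:R / T%:R)%:E)); last first.
    by move=> phi _; exact: PF.
  rewrite sumEFin lee_fin -mulr_suml ler_pdivrMr // mulrAC ler_pdivlMr ?exprn_gt0 ?ltr0n //.
  (* Formulas that are not [k]-CNFs have probability 0, so only non-expanding [k]-CNFs are
     counted. *)
  have -> : \sum_(phi : cnf n (num_clauses c n) | ~~ good n phi) (is_kcnf k phi)%:R =
     #|[pred phi : cnf n (num_clauses c n) |
        is_kcnf k phi && ~~ expanding k (expansion_size C k n) phi]|%:R :> R.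
    rewrite -sum1_card natr_sum big_mkcond [RHS]big_mkcond /=; apply: eq_bigr => phi _.
    by rewrite !inE; case: (is_kcnf k phi); case: (expanding _ _ _).
  by rewrite -natrX -!natrM ler_nat; exact: card_nonexpanding_scaled.
have ae_good := borel_cantelli_inv_square (ler0n _ _) mE PE.
apply: filterS ae_good => w [N0 goodN0].
(* The bound [5 * D] is what the growth estimate asks for; it also gives [gap <= n]. *)
exists (maxn N0 (5 * D)) => n; rewrite geq_max => /andP[nN0 nD] l l_gt0 l_small.
have /negP := goodN0 n nN0; rewrite negbK => /andP[kF expF].
apply: (kcnf_reduction (c := C) (k := k)) => //.
- by apply: leq_trans nD; rewrite leq_pmull.
- exact: bound_of_exp_growth l_small.
Qed.
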